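(* Let $R=(V,E)$ be the Rado graph. The automorphism group $\operatorname{Aut}(R)$ has no mixed identities (in any finite number $r$ of variables).
   Context: The Rado graph is the Fraïssé limit of the class of all finite graphs; equivalently, the (up to isomorphism unique) countable graph such that for all finite disjoint sets $A,B$ of vertices there is a vertex $x$ adjacent to all vertices in $A$ and to no vertex in $B$ (with $x\notin A\cup B$). For a group $G$ and the free group $\mathbf F_r=\langle x_1,\dots,x_r\rangle$, a word with constants in $G$ is an element $w\in G\ast\mathbf F_r$. For $g_1,\dots,g_r\in G$, $w(g_1,\dots,g_r)\in G$ denotes the image of $w$ under the homomorphism $G\ast\mathbf F_r\to G$ that is the identity on $G$ and sends $x_i\mapsto g_i$. The word $w$ is a mixed identity for $G$ if $w\neq1$ in $G\ast\mathbf F_r$ and $w(g_1,\dots,g_r)=1_G$ for all $g_1,\dots,g_r\in G$. *)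

(* Defs.v *)
From HB Require Import structures.
From mathcomp Require Import all_boot finmap boolp.

Set Implicit Arguments.
Unset Strict Implicit.
Unset Printing Implicit Defensive.

Import Algebra.

Local Open Scope group_scope.
Local Open Scope quotient_scope.

(** [A] is a set of letters with a formal inverse [inv], and [R] a set of
    defining relations between words.  [presented_group inv R] is the quotient
    of the free monoid [seq A] by the smallest congruence containing [R] and
    cancelling every letter against its formal inverse. *)

Inductive word_congr (A : Type) (inv : A -> A) (R : seq A -> seq A -> Prop) :
    seq A -> seq A -> Prop :=
| WcRel u v : R u v -> word_congr inv R u v
| WcInvl a : word_congr inv R [:: inv a; a] [::]
| WcInvr a : word_congr inv R [:: a; inv a] [::]
| WcRefl u : word_congr inv R u u
| WcSym u v : word_congr inv R u v -> word_congr inv R v u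
| WcTrans v u w :
    word_congr inv R u v -> word_congr inv R v w -> word_congr inv R u w
| WcCat u u' v v' : word_congr inv R u u' -> word_congr inv R v v' ->
    word_congr inv R (u ++ v) (u' ++ v').

Section PresentedGroup.
Variables (A : choiceType) (inv : A -> A) (R : seq A -> seq A -> Prop).

Definition word_congrb : rel (seq A) := fun u v => `[< word_congr inv R u v >].

Lemma word_congrb_refl : reflexive word_congrb.
Proof. by move=> u; apply/asboolP; apply: WcRefl. Qed.

Lemma word_congrb_sym : symmetric word_congrb.
Proof. by move=> u v; apply/asboolP/asboolP => /WcSym. Qed.

Lemma word_congrb_trans : transitive word_congrb.
Proof.
by move=> v u w /asboolP uv /asboolP vw; apply/asboolP; apply: WcTrans uv vw.
Qed.

Canonical word_congr_equiv :=
  EquivRel word_congrb word_congrb_refl word_congrb_sym word_congrb_trans.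

Definition presented_group : Type := {eq_quot word_congr_equiv}.

HB.instance Definition _ := Choice.on presented_group.

Definition pg_class (u : seq A) : presented_group :=
  \pi_{eq_quot word_congr_equiv} u.
Definition pg_repr (x : presented_group) : seq A :=
  repr (x : {eq_quot word_congr_equiv}).

Lemma pg_reprK : cancel pg_repr pg_class.
Proof. exact: reprK. Qed.

Lemma pg_classP u v : pg_class u = pg_class v <-> word_congr inv R u v.
Proof. by split=> [/eqquotP/asboolP|uv] //; apply/eqquotP/asboolP. Qed.

Lemma pg_repr_class u : word_congr inv R (pg_repr (pg_class u)) u.
Proof. by apply/pg_classP; rewrite pg_reprK. Qed.

Definition pg_one : presented_group := pg_class [::].
Definition pg_mul (x y : presented_group) : presented_group :=
  pg_class (pg_repr x ++ pg_repr y).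
Definition pg_inv (x : presented_group) : presented_group :=
  pg_class (rev (map inv (pg_repr x))).

Lemma pg_classM u v : pg_mul (pg_class u) (pg_class v) = pg_class (u ++ v).
Proof. by apply/pg_classP; apply: WcCat; apply: pg_repr_class. Qed.

Fact pg_mulA : associative pg_mul.
Proof.
move=> x y z; rewrite -[x]pg_reprK -[y]pg_reprK -[z]pg_reprK.
by rewrite !pg_classM catA.
Qed.

Fact pg_mul1 : left_id pg_one pg_mul.
Proof. by move=> x; rewrite -[x]pg_reprK pg_classM. Qed.

Fact pg_mulr1 : right_id pg_one pg_mul.
Proof. by move=> x; rewrite -[x]pg_reprK pg_classM cats0. Qed.

Fact pg_mulV : left_inverse pg_one pg_inv pg_mul.
Proof.
move=> x; rewrite -[x in pg_mul _ x]pg_reprK pg_classM; apply/pg_classP.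
elim: (pg_repr x) => [|a u IHu]; first exact: WcRefl.
rewrite /= rev_cons cat_rcons; apply: WcTrans IHu.
apply: WcCat; first exact: WcRefl.
apply: (WcCat (u := [:: inv a; a]) (u' := [::])); last exact: WcRefl.
exact: WcInvl.
Qed.

Fact pg_mulrV : right_inverse pg_one pg_inv pg_mul.
Proof.
move=> x; rewrite -[x in pg_mul x _]pg_reprK pg_classM; apply/pg_classP.
elim: (pg_repr x) => [|a u IHu]; first exact: WcRefl.
rewrite /= rev_cons -cats1 catA -cat1s.
apply: WcTrans (WcInvr _ _ a).
apply: (WcCat (u := [:: a]) (u' := [:: a])); first exact: WcRefl.
by apply: (WcCat (u' := [::])) IHu _; apply: WcRefl.
Qed.

HB.instance Definition _ := isGroup.Build presented_group
  pg_mulA pg_mul1 pg_mulr1 pg_mulV pg_mulrV.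

Lemma pg_classD u v : pg_class (u ++ v) = pg_class u * pg_class v.
Proof. by rewrite -pg_classM. Qed.

Lemma pg_class0 : pg_class [::] = 1.
Proof. by []. Qed.

Lemma pg_classE u : pg_class u = \prod_(a <- u) pg_class [:: a].
Proof.
elim: u => [|a u IHu]; first by rewrite big_nil.
by rewrite big_cons -IHu -pg_classD.
Qed.

Section Lift.
Variables (K : groupType) (f : A -> K).

Definition pg_lift (x : presented_group) : K := \prod_(a <- pg_repr x) f a.

Hypothesis f_inv : forall a, f (inv a) = (f a)^-1.
Hypothesis f_rel : forall u v, R u v -> \prod_(a <- u) f a = \prod_(a <- v) f a.

Lemma pg_lift_class u : pg_lift (pg_class u) = \prod_(a <- u) f a.
Proof.
rewrite /pg_lift; move: (pg_repr _) (pg_repr_class u) => v; elim=> {u v}.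
- exact: f_rel.
- by move=> a; rewrite !big_cons !big_nil f_inv mulg1 mulVg.
- by move=> a; rewrite !big_cons !big_nil f_inv mulg1 mulgV.
- by [].
- by [].
- by move=> v u w _ -> _ ->.
- by move=> u u' v v' _ equ _ eqv; rewrite !big_cat /= equ eqv.
Qed.

Lemma pg_lift_morphism : monoid_morphism pg_lift.
Proof.
split=> [|x y]; first by rewrite -pg_class0 pg_lift_class big_nil.
by rewrite -[x]pg_reprK -[y]pg_reprK -pg_classD !pg_lift_class big_cat.
Qed.

End Lift.

End PresentedGroup.

(** The letter [(i, false)] stands for [x_i] and [(i, true)] for [x_i^-1]. *)

Definition flip_letter (I : Type) (a : I * bool) : I * bool := (a.1, ~~ a.2).

Definition free_group (r : nat) : Type :=
  presented_group (@flip_letter 'I_r) (fun _ _ => False).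

HB.instance Definition _ r := Group.on (free_group r).

Definition free_gen r (i : 'I_r) : free_group r :=
  pg_class (@flip_letter 'I_r) (fun _ _ => False) [:: (i, false)].

Section FreeLift.
Variables (r : nat) (K : groupType) (g : 'I_r -> K).

Definition free_lift : free_group r -> K :=
  pg_lift (fun a : 'I_r * bool => if a.2 then (g a.1)^-1 else g a.1).

Let letter_inv (a : 'I_r * bool) :
  (if (flip_letter a).2 then (g (flip_letter a).1)^-1
   else g (flip_letter a).1) = (if a.2 then (g a.1)^-1 else g a.1)^-1.
Proof. by case: a => i [] //=; rewrite invgK. Qed.

Fact free_lift_morphism : monoid_morphism free_lift.
Proof. by apply: pg_lift_morphism => // a; apply: letter_inv. Qed.

HB.instance Definition _ := isUMagmaMorphism.Build (free_group r) K free_lift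
  free_lift_morphism.

Lemma free_lift_gen i : free_lift (free_gen i) = g i.
Proof.
by rewrite /free_lift /free_gen (pg_lift_class letter_inv) // big_seq1.
Qed.

Lemma free_lift_unique (h : free_group r -> K) :
  monoid_morphism h -> (forall i, h (free_gen i) = g i) -> h =1 free_lift.
Proof.
move=> [h1 hM] hg x; rewrite -[x]pg_reprK pg_classE.
elim: (pg_repr x) => [|a u IHu].
  by rewrite big_nil h1 (free_lift_morphism.1).
rewrite !big_cons hM (free_lift_morphism.2) IHu; congr (_ * _).
case: a => i []; last by rewrite -/(free_gen i) free_lift_gen.
set y : free_group r := pg_class _ _ _.
have yE : y * free_gen i = 1 by rewrite -pg_classD; apply/pg_classP/(WcInvl _ _ (i, false)).
apply: (mulIg (g i)); rewrite -{1}hg -{1}free_lift_gen.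
by rewrite -hM -(free_lift_morphism.2) yE h1 (free_lift_morphism.1).
Qed.

End FreeLift.

(** The generators of the free product are the elements of [G] and [H], and
    the relations are their multiplication tables; together with cancellation
    these identify [inl 1] and [inr 1] with the empty word. *)

Inductive mul_table (G H : groupType) : seq (G + H) -> seq (G + H) -> Prop :=
| MulTableL (a b : G) : mul_table [:: inl a; inl b] [:: inl (a * b)]
| MulTableR (a b : H) : mul_table [:: inr a; inr b] [:: inr (a * b)].

Definition inv_letter (G H : groupType) (a : G + H) : G + H :=
  match a with inl x => inl x^-1 | inr y => inr y^-1 end.

Definition free_product (G H : groupType) : Type :=
  presented_group (@inv_letter G H) (@mul_table G H).

HB.instance Definition _ G H := Group.on (free_product G H).

Section FreeProduct.
Variables G H : groupType.

Definition fp_inl (x : G) : free_product G H :=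
  pg_class (@inv_letter G H) (@mul_table G H) [:: inl x].
Definition fp_inr (y : H) : free_product G H :=
  pg_class (@inv_letter G H) (@mul_table G H) [:: inr y].

Let morphism_of_mul (K L : groupType) (h : K -> L) :
  {morph h : x y / x * y} -> monoid_morphism h.
Proof.
by move=> hM; split=> //; apply: (mulgI (h 1)); rewrite -hM !mulg1.
Qed.

Fact fp_inl_morphism : monoid_morphism fp_inl.
Proof.
apply: morphism_of_mul => x y; rewrite -pg_classD.
by apply/pg_classP/WcSym/WcRel/MulTableL.
Qed.

Fact fp_inr_morphism : monoid_morphism fp_inr.
Proof.
apply: morphism_of_mul => x y; rewrite -pg_classD.
by apply/pg_classP/WcSym/WcRel/MulTableR.
Qed.

HB.instance Definition _ := isUMagmaMorphism.Build G (free_product G H) fp_inl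
  fp_inl_morphism.
HB.instance Definition _ := isUMagmaMorphism.Build H (free_product G H) fp_inr
  fp_inr_morphism.

Definition fp_lift (K : groupType) (f : G -> K) (g : H -> K) :
    free_product G H -> K :=
  pg_lift (fun a : G + H => match a with inl x => f x | inr y => g y end).

Section Lift.
Variables (K : groupType) (f : UMagmaMorphism.type G K)
  (g : UMagmaMorphism.type H K).

Let letter_inv (a : G + H) :
  match inv_letter a with inl x => f x | inr y => g y end =
  (match a with inl x => f x | inr y => g y end)^-1.
Proof. by case: a => x /=; rewrite gmulfV. Qed.

Let letter_rel (u v : seq (G + H)) : mul_table u v ->
  \prod_(a <- u) match a with inl x => f x | inr y => g y end =
  \prod_(a <- v) match a with inl x => f x | inr y => g y end.
Proof. by case=> a b; rewrite !big_cons !big_nil !mulg1 gmulfM. Qed.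

Fact fp_lift_morphism : monoid_morphism (fp_lift f g).
Proof. by apply: pg_lift_morphism; [apply: letter_inv | apply: letter_rel]. Qed.

HB.instance Definition _ := isUMagmaMorphism.Build (free_product G H) K
  (fp_lift f g) fp_lift_morphism.

Lemma fp_lift_inl x : fp_lift f g (fp_inl x) = f x.
Proof.
by rewrite /fp_lift /fp_inl (pg_lift_class letter_inv letter_rel) big_seq1.
Qed.

Lemma fp_lift_inr y : fp_lift f g (fp_inr y) = g y.
Proof.
by rewrite /fp_lift /fp_inr (pg_lift_class letter_inv letter_rel) big_seq1.
Qed.

Lemma fp_lift_unique (h : free_product G H -> K) : monoid_morphism h ->
  (forall x, h (fp_inl x) = f x) -> (forall y, h (fp_inr y) = g y) ->
  h =1 fp_lift f g.
Proof.
move=> [h1 hM] hf hg x; rewrite -[x]pg_reprK pg_classE.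
elim: (pg_repr x) => [|a u IHu].
  by rewrite big_nil h1 (fp_lift_morphism.1).
rewrite !big_cons hM (fp_lift_morphism.2) IHu; congr (_ * _).
case: a => y; first by rewrite -/(fp_inl y) hf fp_lift_inl.
by rewrite -/(fp_inr y) hg fp_lift_inr.
Qed.

End Lift.

End FreeProduct.

Definition const_word (G : groupType) (r : nat) : groupType :=
  free_product G (free_group r).

Definition word_eval (G : groupType) (r : nat) (g : 'I_r -> G) :
    const_word G r -> G :=
  fp_lift idfun (free_lift g).

Lemma word_eval_morphism (G : groupType) r (g : 'I_r -> G) :
  monoid_morphism (word_eval g).
Proof. exact: fp_lift_morphism. Qed.

Lemma word_eval_const (G : groupType) r (g : 'I_r -> G) (c : G) :
  word_eval g (fp_inl (free_group r) c) = c.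
Proof. exact: fp_lift_inl. Qed.

Lemma word_eval_var (G : groupType) r (g : 'I_r -> G) (i : 'I_r) :
  word_eval g (fp_inr G (free_gen i)) = g i.
Proof. by rewrite /word_eval fp_lift_inr /= free_lift_gen. Qed.

Definition mixed_identity (G : groupType) (r : nat) (w : const_word G r) : Prop :=
  w <> 1 /\ forall g : 'I_r -> G, word_eval g w = 1.

(** The inverse is stored in the record; by [aut_eqP] an automorphism is still
    determined by its underlying function. *)

Record graph_aut (V : Type) (E : rel V) : Type := GraphAut {
  aut_fun :> V -> V;
  aut_inv : V -> V;
  aut_funK : cancel aut_fun aut_inv;
  aut_invK : cancel aut_inv aut_fun;
  aut_edge : forall x y, E (aut_fun x) (aut_fun y) = E x y
}.

Section GraphAut.
Variables (V : Type) (E : rel V).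

HB.instance Definition _ := gen_eqMixin (graph_aut E).
HB.instance Definition _ := gen_choiceMixin (graph_aut E).

Lemma aut_eqP (f g : graph_aut E) : f =1 g -> f = g.
Proof.
case: f g => [f f' fK f'K fE] [g g' gK g'K gE] /= /funext fg.
case: _ / fg gK g'K gE => gK g'K gE.
have f'g' : f' = g' by apply: funext => x; rewrite -{1}[x]g'K fK.
case: _ / f'g' gK g'K gE => gK g'K gE.
by congr GraphAut; apply: Prop_irrelevance.
Qed.

Definition aut_one : graph_aut E :=
  @GraphAut V E id id (frefl id) (frefl id) (fun _ _ => erefl).

Definition aut_mul (f g : graph_aut E) : graph_aut E :=
  @GraphAut V E (f \o g) (aut_inv g \o aut_inv f)
    (can_comp (aut_funK f) (aut_funK g)) (can_comp (aut_invK g) (aut_invK f))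
    (fun x y => etrans (aut_edge f (g x) (g y)) (aut_edge g x y)).

Fact aut_inv_edge (f : graph_aut E) x y : E (aut_inv f x) (aut_inv f y) = E x y.
Proof. by rewrite -(aut_edge f) !aut_invK. Qed.

Definition aut_opp (f : graph_aut E) : graph_aut E :=
  GraphAut (aut_invK f) (aut_funK f) (aut_inv_edge f).

Fact aut_mulA : associative aut_mul.
Proof. by move=> f g h; apply: aut_eqP. Qed.
Fact aut_mul1 : left_id aut_one aut_mul.
Proof. by move=> f; apply: aut_eqP. Qed.
Fact aut_mulr1 : right_id aut_one aut_mul.
Proof. by move=> f; apply: aut_eqP. Qed.
Fact aut_mulV : left_inverse aut_one aut_opp aut_mul.
Proof. by move=> f; apply: aut_eqP => x /=; rewrite aut_funK. Qed.
Fact aut_mulrV : right_inverse aut_one aut_opp aut_mul.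
Proof. by move=> f; apply: aut_eqP => x /=; rewrite aut_invK. Qed.

HB.instance Definition _ := isGroup.Build (graph_aut E)
  aut_mulA aut_mul1 aut_mulr1 aut_mulV aut_mulrV.

End GraphAut.

(** The extension property forces [V] to be infinite, so [countType] means
    countably infinite here. *)

Record rado_graph (V : countType) (E : rel V) : Prop := RadoGraph {
  rado_sym : symmetric E;
  rado_irrefl : irreflexive E;
  rado_ext : forall A B : {fset V}, [disjoint A & B]%fset ->
    exists x : V, [/\ x \notin A, x \notin B,
                      forall a, a \in A -> E x a &
                      forall b, b \in B -> ~~ E x b]
}.

(* Main.v *)
Require Import Defs.
From mathcomp Require Import finmap.
From mathcomp Require Import all_boot boolp.

(** A word that is not a constant can be written without cancellation as
    [c_0 x_(a_1) c_1 ... x_(a_l) c_l]: if [c_j = 1] then [a_(j+1)] is not the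
    inverse of [a_j].  Fix a vertex [v] and follow it through the word from right
    to left, defining the variables on the way as finite partial isomorphisms:
    whenever a letter has to be applied to a vertex, map that vertex to a generic
    one.  It can be chosen of any prescribed type, outside any given finite set,
    and not fixed by a given [c <> 1], because such a [c] moves infinitely many
    vertices.  So the next constant carries it outside the current domain of the
    next letter, and the last constant does not carry it back to [v].
    Back-and-forth extends the partial isomorphisms to automorphisms. *)

Set Implicit Arguments.
Unset Strict Implicit.
Unset Printing Implicit Defensive.

Import Algebra.
Local Open Scope group_scope.

(** * Reduced forms of words with constants *)

Section ReducedForm.
Variables (G : groupType) (r : nat).
Implicit Types (a : 'I_r * bool) (c : G) (l : seq (('I_r * bool) * G)).

Definition letter_val (K : groupType) (g : 'I_r -> K) a : K :=
  if a.2 then (g a.1)^-1 else g a.1.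

Definition tail_val (K : groupType) (f : G -> K) (g : 'I_r -> K) l : K :=
  \prod_(p <- l) (letter_val g p.1 * f p.2).

(** Each letter is paired with the constant to its right, so [p.2] is what separates the letters
    [p.1] and [q.1]. *)
Definition no_cancel (p q : ('I_r * bool) * G) : bool :=
  ~~ ((p.2 == 1) && (q.1 == flip_letter p.1)).

Definition word_of (c : G) l : const_word G r :=
  fp_inl _ c * tail_val (@fp_inl G (free_group r))
                 (fun i => fp_inr G (free_gen i)) l.

Definition has_normal_form (w : const_word G r) : Prop :=
  exists c l, sorted no_cancel l /\ w = word_of c l.

Lemma letter_valV (K : groupType) (g : 'I_r -> K) a :
  letter_val g a * letter_val g (flip_letter a) = 1.
Proof. by case: a => i []; rewrite /letter_val /= ?mulVg ?mulgV. Qed.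

Lemma normal_mul_const c w :
  has_normal_form w -> has_normal_form (fp_inl _ c * w).
Proof.
move=> [d [l [sl ->]]]; exists (c * d), l; split=> //.
by rewrite /word_of mulgA gmulfM.
Qed.

(** If prepending [a] breaks reducedness, then [d = 1] and the first letter is the inverse of [a];
    the two cancel and the rest of the list is still reduced. *)
Lemma normal_mul_letter a w : has_normal_form w ->
  has_normal_form (letter_val (fun i => fp_inr G (free_gen i)) a * w).
Proof.
move=> [d [l [sl ->]]]; have [sal|] := boolP (sorted no_cancel ((a, d) :: l)).
  exists 1, ((a, d) :: l); split=> //.
  by rewrite /word_of /tail_val big_cons gmulf1 mul1g mulgA.
case: l sl => [|[b e] l] //= sl; rewrite sl andbT negbK => /andP[/= /eqP-> /eqP->].
exists e, l; split; first exact: path_sorted sl.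
by rewrite /word_of /tail_val big_cons gmulf1 mul1g /= !mulgA letter_valV mul1g.
Qed.

Lemma fp_inr_letter a :
  fp_inr G (pg_class (@flip_letter 'I_r) (fun _ _ => False) [:: a] : free_group r)
  = letter_val (fun i => fp_inr G (free_gen i)) a.
Proof.
case: a => i [] //; rewrite /letter_val /=.
apply: (mulgI (fp_inr G (free_gen i))); rewrite mulgV -gmulfM -[RHS](gmulf1 (s := @fp_inr G (free_group r))).
by congr fp_inr; rewrite /free_gen -pg_classD; apply/pg_classP/(WcInvr _ _ (i, false)).
Qed.

Lemma normal_mul_free (y : free_group r) w :
  has_normal_form w -> has_normal_form (fp_inr G y * w).
Proof.
move=> nw; rewrite -[y]pg_reprK; elim: (pg_repr y) => [|a u IHu].
  by rewrite pg_class0 gmulf1 mul1g.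
rewrite -cat1s pg_classD gmulfM /= fp_inr_letter -mulgA.
exact: normal_mul_letter.
Qed.

Lemma normal_form w : has_normal_form w.
Proof.
rewrite -[w]pg_reprK pg_classE.
elim: (pg_repr w) => [|[c|y] u IHu].
- by exists 1, [::]; split=> //; rewrite /word_of /tail_val !big_nil gmulf1 mulg1.
- by rewrite big_cons; apply: normal_mul_const.
- by rewrite big_cons; apply: normal_mul_free.
Qed.

Lemma word_eval_word_of (g : 'I_r -> G) c l :
  word_eval g (word_of c l) = c * tail_val idfun g l.
Proof.
have [e1 eM] := word_eval_morphism g.
rewrite /word_of eM word_eval_const; congr (_ * _).
elim: l => [|[[i b] d] l IHl]; first by rewrite /tail_val !big_nil e1.
rewrite /tail_val !big_cons !eM -/(tail_val _ _ l) IHl word_eval_const.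
congr (_ * _ * _); case: b; rewrite /letter_val /= -?gmulfV ?word_eval_var //.
apply: (mulgI (g i)); rewrite mulgV -[X in X * _](word_eval_var g i) -eM.
by rewrite -gmulfM mulgV gmulf1 e1.
Qed.

End ReducedForm.

(** * Generic vertices, finite partial isomorphisms and back-and-forth *)

Section PartialIso.
Variables (V : countType) (E : rel V).
Hypothesis radoE : rado_graph E.
Implicit Types (s : seq (V * V)) (F : seq V) (P : pred V) (c : graph_aut E).

Lemma rado_type P F :
  exists2 y, y \notin F & {in F, forall b, E y b = P b}.
Proof.
have dAB : [disjoint [fset b in [seq b <- F | P b]] &
                     [fset b in [seq b <- F | ~~ P b]]]%fset.
  by apply/fdisjointP => b; rewrite !finmap.inE !mem_filter => /andP[-> _].
have [y [yA yB EA EB]] := rado_ext radoE dAB; exists y.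
  by apply: contraNN yA => yF; move: yB; rewrite !finmap.inE !mem_filter yF !andbT negbK.
move=> b bF; case: (boolP (P b)) => Pb.
  by apply: EA; rewrite !finmap.inE mem_filter Pb.
by apply/negbTE/EB; rewrite !finmap.inE mem_filter Pb.
Qed.

Lemma moved_vertex c F : c <> 1 -> exists2 z, z \notin F & c z <> z.
Proof.
move=> c1; have [a ca] : exists a, c a <> a.
  apply: contrapT => nca; apply: c1; apply: aut_eqP => a.
  by apply: contrapT => ca; apply: nca; exists a.
(* A vertex adjacent to [a] but not to [c a] cannot be fixed by [c]. *)
have [z zF zE] := rado_type (pred1 a) [:: a, c a & F].
exists z; first by move: zF; rewrite !inE !negb_or => /and3P[].
move=> cz; have := aut_edge c z a; rewrite cz.
rewrite !zE ?inE ?eqxx ?orbT //= => /eqP; exact: ca.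
Qed.

Lemma rado_type_moved c P F :
  exists y, [/\ y \notin F, {in F, forall b, E y b = P b} & c <> 1 -> c y <> y].
Proof.
have [->|c1] := pselect (c = 1).
  by have [y yF yP] := rado_type P F; exists y.
(* Both [z] and [c z] avoid [F], so adjacency to them can be prescribed independently of [P]; making
   [y] adjacent to [z] only forces [c y <> y]. *)
have [z zF cz] := moved_vertex (F ++ map (aut_inv c) F) c1.
move: zF; rewrite mem_cat negb_or => /andP[zF czF].
have {}czF : c z \notin F.
  by apply: contraNN czF => /(map_f (aut_inv c)); rewrite aut_funK.
have [y yF yP] := rado_type (fun b => (b == z) || (b != c z) && P b) [:: z, c z & F].
exists y; split.
- by move: yF; rewrite !inE !negb_or => /and3P[].
- move=> b bF; rewrite yP ?inE ?bF ?orbT //.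
  have /negbTE-> : b != z by apply: contraNneq zF => <-.
  by have -> : b != c z by apply: contraNneq czF => <-.
- move=> _ cy; have := aut_edge c y z; rewrite cy !yP ?inE ?eqxx ?orbT //=.
  by rewrite orbF => /eqP; apply: cz.
Qed.

(** The equality clause makes the list the graph of an injective function, a condition symmetric
    under swapping the pairs. *)
Definition partial_iso s : Prop := {in s &, forall p q,
  (p.1 == q.1) = (p.2 == q.2) /\ E p.1 q.1 = E p.2 q.2}.

Lemma partial_iso_swap s : partial_iso s -> partial_iso (map swap_pair s).
Proof.
move=> si _ _ /mapP[p ps ->] /mapP[q qs ->] /=.
by have [-> ->] := si _ _ ps qs.
Qed.

Lemma partial_iso_extend s x F c : partial_iso s -> x \notin unzip1 s ->
  exists y, [/\ y \notin F, c <> 1 -> c y <> y & partial_iso ((x, y) :: s)].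
Proof.
move=> si xs.
(* The type of [x] over the domain of [s], transported along [s] to its range. *)
have [y [yF yP cy]] := rado_type_moved c
  (fun b => has (fun p => (p.2 == b) && E x p.1) s) (unzip2 s ++ F).
move: yF; rewrite mem_cat negb_or => /andP[ys yF].
exists y; split=> //.
have fresh p : p \in s -> [/\ (x == p.1) = false, (y == p.2) = false & E x p.1 = E y p.2].
  move=> ps; split.
  - by apply: contraNF xs => /eqP->; apply: map_f.
  - by apply: contraNF ys => /eqP->; apply: map_f.
  - rewrite yP; last by rewrite mem_cat map_f.
    apply/idP/hasP => [Exp|[q qs /andP[qp Exq]]]; first by exists p; rewrite ?eqxx.
    by have [] := si _ _ qs ps; rewrite qp => /eqP<-.
have sym := rado_sym radoE; have irr := rado_irrefl radoE.
move=> p q; rewrite !inE => /predU1P[->|ps] /predU1P[->|qs] /=.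
- by rewrite !eqxx !irr.
- by have [-> -> ->] := fresh _ qs.
- by have [] := fresh _ ps; rewrite eq_sym => -> ; rewrite eq_sym => -> ; rewrite sym => ->; rewrite sym.
- exact: si.
Qed.

Lemma partial_iso_extend_dom s x : partial_iso s ->
  exists t, [/\ partial_iso t, {subset s <= t} & x \in unzip1 t].
Proof.
move=> si; have [xs|xs] := boolP (x \in unzip1 s); first by exists s; split.
have [y [_ _ ti]] := partial_iso_extend [::] 1 si xs.
exists ((x, y) :: s); split=> //=; last by rewrite inE eqxx.
by move=> p ps; rewrite inE ps orbT.
Qed.

(** The range is treated by extending the domain of the swapped list. *)
Lemma partial_iso_extend_both s x : partial_iso s ->
  exists t, [/\ partial_iso t, {subset s <= t}, x \in unzip1 t & x \in unzip2 t].
Proof.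
move=> /(partial_iso_extend_dom x)[t [ti st xt]].
have [u [ui tu xu]] := partial_iso_extend_dom x (partial_iso_swap ti).
have sub : {subset t <= map swap_pair u}.
  by case=> a b abt; apply/mapP; exists (b, a) => //; apply/tu/mapP; exists (a, b).
exists (map swap_pair u); split.
- exact: partial_iso_swap.
- by move=> p /st/sub.
- by move/mapP: xt => [p /sub pu ->]; apply: map_f.
- by rewrite /unzip2 -map_comp.
Qed.

Lemma partial_iso_automorphism s : partial_iso s ->
  exists g : graph_aut E, {in s, forall p, g p.1 = p.2}.
Proof.
move=> si.
(* The hypothesis on [nt.2] is placed under the existential so that [choice] yields a total
   function. *)
have step (nt : nat * seq (V * V)) : exists t, partial_iso nt.2 ->
    [/\ partial_iso t, {subset nt.2 <= t} &
      forall x, unpickle nt.1 = Some x -> x \in unzip1 t /\ x \in unzip2 t].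
  case: nt => n t /=; have [ti|nti] := pselect (partial_iso t); last by exists t.
  case: (unpickle n) => [x|]; last by exists t; split.
  have [u [ui tu x1 x2]] := partial_iso_extend_both x ti.
  by exists u => _; split=> // _ [<-].
have [next nextP] := choice step.
(* Passing from stage [m] to [m.+1] handles the vertex coded by [m], so [x] is covered from stage
   [(pickle x).+1] on. Any two pairs lie in a common stage, which is what makes the union a
   bijection preserving [E]. *)
pose S := fix S n := if n is m.+1 then next (m, S m) else s.
have Si n : partial_iso (S n) by elim: n => //= n /(nextP (n, _))[].
have Smono m n : m <= n -> {subset S m <= S n}.
  elim: n => [|n IHn]; first by rewrite leqn0 => /eqP->.
  rewrite leq_eqVlt => /predU1P[->//|/IHn sub p /sub].
  by have [_ sub' _] := nextP (n, S n) (Si n); apply: sub'.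
have Scommon p q m n : p \in S m -> q \in S n ->
    (p.1 == q.1) = (p.2 == q.2) /\ E p.1 q.1 = E p.2 q.2.
  move=> /(Smono _ _ (leq_maxl m n)) pS /(Smono _ _ (leq_maxr m n)) qS.
  exact: (Si _ _ _ pS qS).
have Stot x : x \in unzip1 (S (pickle x).+1) /\ x \in unzip2 (S (pickle x).+1).
  by have [_ _ xS] := nextP (pickle x, S (pickle x)) (Si _); exact: xS (pickleK x).
have /choice[g gP] x : exists y n, (x, y) \in S n.
  by have [/mapP[[a b] /= abS ->] _] := Stot x; exists b, (pickle x).+1.
have /choice[h hP] y : exists x n, (x, y) \in S n.
  by have [_ /mapP[[a b] /= abS ->]] := Stot y; exists a, (pickle y).+1.
have gK : cancel g h.
  move=> x; have [[m gS] [n hS]] := (gP x, hP (g x)).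
  by apply/eqP; have [-> _] := Scommon _ _ _ _ hS gS; rewrite eqxx.
have hK : cancel h g.
  move=> y; have [[m gS] [n hS]] := (gP (h y), hP y).
  by apply/eqP; have [/= <- _] := Scommon _ _ _ _ gS hS.
have gE x y : E (g x) (g y) = E x y.
  by have [[m xS] [n yS]] := (gP x, gP y); have [_ /= ->] := Scommon _ _ _ _ xS yS.
exists (GraphAut gK hK gE) => -[a b] abs /=; have [n aS] := gP a.
(* Stage [0] is [s] itself. *)
by apply/eqP; have [/= <- _] := Scommon _ _ n 0 aS abs.
Qed.

End PartialIso.

(** * Following a vertex through a reduced word *)

Section FollowWord.
Variables (V : countType) (E : rel V) (r : nat).
Hypothesis radoE : rado_graph E.
Let G := graph_aut E.
Implicit Types (s : 'I_r -> seq (V * V)) (a : 'I_r * bool)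
  (l : seq (('I_r * bool) * G)) (c : G) (v : V) (F : seq V).

Definition letter_graph s a : seq (V * V) :=
  if a.2 then map swap_pair (s a.1) else s a.1.

Definition add_pair s a x y : 'I_r -> seq (V * V) := fun i =>
  if i == a.1 then (if a.2 then (y, x) else (x, y)) :: s i else s i.

(** The path of [v] is read from right to left using only recorded pairs, hence it survives any
    extension of the partial maps. *)
Fixpoint follows s l v z : Prop :=
  if l is (a, c) :: l' then
    exists2 p, follows s l' v p & (c p, z) \in letter_graph s a
  else z = v.

Lemma letter_graph_add s a x y b :
  letter_graph (add_pair s a x y) b =
    if b == a then (x, y) :: letter_graph s b
    else if b == flip_letter a then (y, x) :: letter_graph s b
    else letter_graph s b.
Proof.
case: a b => i e [j d]; rewrite /letter_graph /add_pair /flip_letter !xpair_eqE /=.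
by case: eqP; case: e; case: d.
Qed.

Lemma partial_iso_letter_graph s a :
  (forall i, partial_iso E (s i)) -> partial_iso E (letter_graph s a).
Proof. by rewrite /letter_graph; case: a.2 => si //; apply: partial_iso_swap. Qed.

Lemma partial_iso_add_pair s a x y : (forall i, partial_iso E (s i)) ->
  partial_iso E ((x, y) :: letter_graph s a) ->
  forall i, partial_iso E (add_pair s a x y i).
Proof.
move=> si; rewrite /letter_graph /add_pair => sa i; case: eqP => [->|//].
case: a.2 sa => // /partial_iso_swap.
by rewrite /= -map_comp map_id_in // => -[].
Qed.

(** Here [b] is the letter applied after [a] and [c]. Besides its old domain, [c z] must avoid [x]
    if [b = a], and [z] if [b] is the inverse of [a]; in the latter case reducedness gives [c <> 1],
    so [z] can be chosen not fixed by [c]. *)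
Lemma extend_letter s a x c F b :
  (forall i, partial_iso E (s i)) -> x \notin unzip1 (letter_graph s a) ->
  ~~ ((c == 1) && (a == flip_letter b)) ->
  exists t z, [/\ forall i, partial_iso E (t i),
    forall d, {subset letter_graph s d <= letter_graph t d},
    (x, z) \in letter_graph t a,
    c z \notin F & c z \notin unzip1 (letter_graph t b)].
Proof.
move=> si xa cab.
have [z [zF cz ti]] := partial_iso_extend radoE
  (* Conditions on [c z] become conditions on [z] after pulling back by [c]. *)
  (map (aut_inv c) (x :: F ++ unzip1 (letter_graph s b))) c
  (partial_iso_letter_graph si) xa.
have : c z \notin x :: F ++ unzip1 (letter_graph s b).
  by apply: contraNN zF => /(map_f (aut_inv c)); rewrite aut_funK.
rewrite inE mem_cat !negb_or => /and3P[czx czF czb].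
exists (add_pair s a x z), z; split=> //.
- exact: partial_iso_add_pair.
- move=> d p ps; rewrite letter_graph_add.
  by case: ifP => _; [|case: ifP => _]; rewrite ?inE ps ?orbT.
- by rewrite letter_graph_add eqxx inE eqxx.
- rewrite letter_graph_add; case: eqP => [_|_]; first by rewrite inE negb_or czx.
  case: eqP => [ba|_] //; rewrite inE negb_or czb andbT.
  apply/eqP/cz => c1; move/negP: cab; apply; rewrite c1 ba eqxx /=.
  by case: (a) => i e; rewrite /flip_letter /= negbK.
Qed.

Lemma follows_mono s t l v z :
  (forall d, {subset letter_graph s d <= letter_graph t d}) ->
  follows s l v z -> follows t l v z.
Proof.
move=> st; elim: l z => [|[a c] l IHl] z //= [p /IHl lp /st cp].
by exists p.
Qed.

(** Induction from the right end of the word; the last clause is the invariant that leaves the image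
    under the next letter [a] free to be chosen. *)
Lemma follows_exists l a c v : sorted (@no_cancel G r) ((a, c) :: l) ->
  exists s p, [/\ forall i, partial_iso E (s i), follows s l v p &
    c p \notin unzip1 (letter_graph s a)].
Proof.
elim: l a c => [|[b d] l IHl] a c.
  by exists (fun=> [::]), v; split=> //; rewrite /letter_graph; case: ifP.
move=> /= /andP[ncab sl]; have [s [p [si sp dp]]] := IHl b d sl.
have [t [z [ti st zt _ cz]]] := extend_letter [::] si dp ncab.
exists t, z; split=> //=; exists p => //; exact: follows_mono sp.
Qed.

Lemma follows_tail_val s l v z (g : 'I_r -> G) :
  (forall i, {in s i, forall p, g i p.1 = p.2}) ->
  follows s l v z -> tail_val idfun g l v = z.
Proof.
move=> gs; elim: l z => [|[a c] l IHl] z; first by rewrite /tail_val big_nil.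
move=> /= [p /IHl lp cp]; rewrite /tail_val big_cons /= -/(tail_val _ _ l) lp.
move: cp; rewrite /letter_graph /letter_val; case: a.2; last by move/gs.
by case/mapP=> -[x y] /gs /= <- [-> ->]; apply: aut_funK.
Qed.

Lemma reduced_word_moves c0 a c l v : sorted (@no_cancel G r) ((a, c) :: l) ->
  exists g : 'I_r -> G, (c0 * tail_val idfun g ((a, c) :: l)) v <> v.
Proof.
move=> sl; have [s [p [si sp cp]]] := follows_exists v sl.
(* No letter follows the leftmost one, so [a] itself fills the place of [b]: it is never its own
   inverse. Taking [[:: v]] as the set to avoid gives [c0 z <> v]. *)
have c0a : ~~ ((c0 == 1) && (a == flip_letter a)).
  by case: (a) => i []; rewrite /flip_letter xpair_eqE !andbF.
have [t [z [ti st zt c0z _]]] := extend_letter [:: v] si cp c0a.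
have [g gP] := choice (fun i => partial_iso_automorphism radoE (ti i)).
exists g; have := follows_tail_val (l := (a, c) :: l) gP => /(_ v z) gz.
rewrite /= gz; first by apply/eqP; rewrite -(mem_seq1 _ v).
by exists p => //; apply: follows_mono sp.
Qed.

End FollowWord.

Theorem corollary4p1p2 (V : countType) (E : rel V) (radoE : rado_graph E)
    (r : nat) :
  ~ exists w : const_word (graph_aut E) r, mixed_identity w.
Proof.
case=> w [w1 wg]; have [c0 [[|[a c] l] [sl wE]]] := normal_form w; subst w.
  (* A word without variables evaluates to its constant, so [c0 = 1] and the word is trivial. *)
  apply: w1; have := wg (fun=> 1).
  by rewrite word_eval_word_of /word_of /tail_val !big_nil !mulg1 => ->; apply: gmulf1.
(* The extension property for empty sets supplies a vertex to follow. *)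
have [v _ _] := rado_type radoE xpred0 [::].
have [g] := reduced_word_moves radoE c0 v sl; apply.
by rewrite -word_eval_word_of wg.
Qed.
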